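(* Let $\mathcal C=\mathcal C(I,A,(\rho_i)_{i\in I},(C^a)_{a\in A})$ be a Cartan scheme such that $\mathcal R^{\mathrm{re}}(\mathcal C)$ is a finite root system of type $\mathcal C$. Let $a\in A$ and $u,v\in \operatorname{Hom}(\mathcal W(\mathcal C),a)$. Then \[ J(u)\cup J(v)=J(u\wedge v)\cup J(u^{-1}v), \] where $u\wedge v$ is the meet of $u$ and $v$ in $\operatorname{Hom}(\mathcal W(\mathcal C),a)$ with respect to the weak order.
   Context: Cartan schemes. Let $I,A$ be finite sets, $A\neq\emptyset$, and $(\alpha_i)_{i\in I}$ the standard basis of $\mathbb Z^I$. A Cartan scheme $\mathcal C=\mathcal C(I,A,(\rho_i)_{i\in I},(C^a)_{a\in A})$ consists of maps $\rho_i:A\to A$ ($i\in I$) and (integer) generalized Cartan matrices $C^a=(c^a_{jk})_{j,k\in I}$ ($a\in A$) such that $\rho_i^2=\mathrm{id}$ and $c^a_{ij}=c^{\rho_i(a)}_{ij}$ for all $a\in A$, $i,j\in I$. Define $\sigma_i^a\in\operatorname{Aut}(\mathbb Z^I)$ by $\sigma_i^a(\alpha_j)=\alpha_j-c^a_{ij}\alpha_i$ for all $j\in I$. Weyl groupoid. $\mathcal W(\mathcal C)$ is the category (a groupoid) with object set $A$ whose morphisms are the compositions of the maps $\sigma_i^a$, each regarded as an element of $\operatorname{Hom}(a,\rho_i(a))$ (morphisms with the same source and target are equal iff they are equal as linear maps). Upper indices are omitted when determined by context; $\mathrm{id}^a\sigma_{i_1}\cdots\sigma_{i_k}$ denotes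 the composition with target $a$. $\operatorname{Hom}(\mathcal W(\mathcal C),a)$ is the disjoint union $\bigcup_{b\in A}\operatorname{Hom}(b,a)$. Roots. $(R^{\mathrm{re}})^a=\{\mathrm{id}^a\sigma_{i_1}\cdots\sigma_{i_k}(\alpha_j)\mid k\ge 0,\ i_1,\dots,i_k,j\in I\}$, and $\mathcal R^{\mathrm{re}}(\mathcal C)=(\mathcal C,((R^{\mathrm{re}})^a)_{a\in A})$. A family $(R^a)_{a\in A}$ of subsets of $\mathbb Z^I$ is a root system of type $\mathcal C$ if, with $R^a_+=R^a\cap\mathbb N_0^I$ and $m^a_{i,j}=|R^a\cap(\mathbb N_0\alpha_i+\mathbb N_0\alpha_j)|$: (R1) $R^a=R^a_+\cup -R^a_+$; (R2) $R^a\cap\mathbb Z\alpha_i=\{\alpha_i,-\alpha_i\}$; (R3) $\sigma_i^a(R^a)=R^{\rho_i(a)}$; (R4) if $i\ne j$ and $m^a_{i,j}$ is finite then $(\rho_i\rho_j)^{m^a_{i,j}}(a)=a$; for all $a\in A$, $i,j\in I$. It is finite if every $R^a$ is finite. Length and weak order. For a morphism $w$, $\ell(w)$ is the least $k\ge0$ such that $w$ is a composition $\sigma_{i_1}\cdots\sigma_{i_k}^b$; such a decomposition with $k=\ell(w)$ is called reduced. For $u\in\operatorname{Hom}(b,a)$, $v\in\operatorname{Hom}(c,b)$ put $u\le_R uv$ iff $\ell(u)+\ell(v)=\ell(uv)$; this is a partial order on $\operatorname{Hom}(\mathcal W(\mathcal C),a)$ (weak order), and any two elements have a meet. Letters. For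 a morphism $w$ with reduced decomposition $w=\sigma_{i_1}\cdots\sigma_{i_k}^b$, $J(w):=\{i_1,\dots,i_k\}\subseteq I$; this set does not depend on the chosen reduced decomposition. *)

(* Defs.v *)
From HB Require Import structures.
From mathcomp Require Import all_boot all_order all_algebra.
From mathcomp Require Import boolp classical_sets functions cardinality.
Set Implicit Arguments.
Unset Strict Implicit.
Unset Printing Implicit Defensive.
Import Order.TTheory GRing.Theory Num.Theory.
Local Open Scope ring_scope.

(** * Cartan schemes *)

Definition generalized_cartan_matrix (I : finType) (c : I -> I -> int) : Prop :=
  [/\ forall i, c i i = 2,
      forall i j, i != j -> c i j <= 0
    & forall i j, c i j = 0 -> c j i = 0].

Record cartan_scheme (I A : finType) := CartanScheme {
  rho : I -> A -> A;
  cartan : A -> I -> I -> int;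
  objects_nonempty : (0 < #|A|)%N;
  rho_involutive : forall i a, rho i (rho i a) = a;
  cartan_gcm : forall a, generalized_cartan_matrix (cartan a);
  cartan_rho : forall a i j, cartan a i j = cartan (rho i a) i j
}.

Notation root_lattice I := {ffun I -> int}.

Definition alpha (I : finType) (i : I) : root_lattice I :=
  [ffun j => (j == i)%:R].

(* The linear extension of alpha_j |-> alpha_j - c^a_{ij} alpha_i
   (see [sigma_alpha] and [sigma_additive]). *)
Definition sigma (I A : finType) (C : cartan_scheme I A) (i : I) (a : A)
    (x : root_lattice I) : root_lattice I :=
  x - alpha i *~ (\sum_j cartan C a i j * x j).

Lemma sigma_alpha (I A : finType) (C : cartan_scheme I A) (i j : I) (a : A) :
  sigma C i a (alpha j) = alpha j - alpha i *~ cartan C a i j.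
Proof.
rewrite /sigma (bigD1 j) //= ffunE eqxx mulr1 big1 ?addr0 // => k kj.
by rewrite ffunE (negPf kj) mulr0.
Qed.

Lemma sigma_additive (I A : finType) (C : cartan_scheme I A) (i : I) (a : A)
    (x y : root_lattice I) :
  sigma C i a (x + y) = sigma C i a x + sigma C i a y.
Proof.
rewrite /sigma addrACA -opprD -mulrzDr -big_split /=; congr (_ - _ *~ _).
by apply: eq_bigr => j _; rewrite ffunE mulrDr.
Qed.

Lemma ffun_mulrzE (I : finType) (x : root_lattice I) (n : int) (j : I) :
  (x *~ n) j = x j * n.
Proof.
case: n => n; first by rewrite -pmulrn ffunMnE -mulr_natr natz.
by rewrite NegzE !mulrNz -pmulrn ffunE ffunMnE -mulr_natr mulrN natz.
Qed.

Lemma sigmaK (I A : finType) (C : cartan_scheme I A) (i : I) (a : A) :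
  cancel (sigma C i a) (sigma C i (rho C i a)).
Proof.
move=> x; rewrite {1}/sigma.
under eq_bigr do rewrite -cartan_rho.
suff -> : \sum_j cartan C a i j * sigma C i a x j
          = - \sum_j cartan C a i j * x j.
  by rewrite mulrNz opprK /sigma subrK.
rewrite /sigma; set n := \sum_j cartan C a i j * x j.
have -> : \sum_j cartan C a i j * (x - alpha i *~ n) j
          = n - \sum_j cartan C a i j * (j == i)%:R * n.
  rewrite /n -sumrB; apply: eq_bigr => j _.
  by rewrite ffunE [X in x j + X]ffunE ffun_mulrzE ffunE mulrBr mulrA.
rewrite (bigD1 i) //= eqxx mulr1 big1 ?addr0 => [|j ji]; last first.
  by rewrite (negPf ji) mulr0 mul0r.
have [-> _ _] := cartan_gcm C a.
by rewrite mulrDl mul1r opprD addrA subrr add0r.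
Qed.

(** * The Weyl groupoid *)

(* [word_map C a [:: i_1; ..; i_k]] is id^a sigma_{i_1} ... sigma_{i_k}, whose
   target is [a] and whose source is [word_source C a [:: i_1; ..; i_k]]. *)
Fixpoint word_source (I A : finType) (C : cartan_scheme I A) (a : A)
    (s : seq I) : A :=
  if s is i :: s' then word_source C (rho C i a) s' else a.

Fixpoint word_map (I A : finType) (C : cartan_scheme I A) (a : A)
    (s : seq I) : root_lattice I -> root_lattice I :=
  if s is i :: s' then sigma C i (rho C i a) \o word_map C (rho C i a) s'
  else id.

Definition decomposes (I A : finType) (C : cartan_scheme I A) (b a : A)
    (f : root_lattice I -> root_lattice I) (s : seq I) : Prop :=
  word_source C a s = b /\ word_map C a s = f.

Record wg_hom (I A : finType) (C : cartan_scheme I A) (b a : A) := WgHom {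
  hom_map :> root_lattice I -> root_lattice I;
  hom_decomposes : exists s, decomposes C b a hom_map s
}.

Lemma hom_ext (I A : finType) (C : cartan_scheme I A) (b a : A)
    (f g : wg_hom C b a) :
  hom_map f = hom_map g -> f = g.
Proof.
case: f g => f Hf [g Hg] /= fg; subst g.
by congr WgHom; apply: Prop_irrelevance.
Qed.

Lemma word_source_cat (I A : finType) (C : cartan_scheme I A) (a : A)
    (s t : seq I) :
  word_source C a (s ++ t) = word_source C (word_source C a s) t.
Proof. by elim: s a => //= i s IH a; rewrite IH. Qed.

Lemma word_map_cat (I A : finType) (C : cartan_scheme I A) (a : A)
    (s t : seq I) :
  word_map C a (s ++ t) = word_map C a s \o word_map C (word_source C a s) t.
Proof. by elim: s a => //= i s IH a; rewrite IH. Qed.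

Lemma word_source_rev (I A : finType) (C : cartan_scheme I A) (a : A)
    (s : seq I) :
  word_source C (word_source C a s) (rev s) = a.
Proof.
elim: s a => //= i s IH a.
by rewrite rev_cons -cats1 word_source_cat IH /= rho_involutive.
Qed.

Lemma word_map_rev (I A : finType) (C : cartan_scheme I A) (a : A)
    (s : seq I) :
  cancel (word_map C (word_source C a s) (rev s)) (word_map C a s) /\
  cancel (word_map C a s) (word_map C (word_source C a s) (rev s)).
Proof.
elim: s a => [|i s IH] a /=; first by split.
rewrite rev_cons -cats1 word_map_cat word_source_rev /= rho_involutive.
have [IH1 IH2] := IH (rho C i a).
split=> x /=; first by rewrite IH1 sigmaK.
by rewrite -{2}(rho_involutive C i a) sigmaK IH2.
Qed.

Lemma hom_comp_decomposes (I A : finType) (C : cartan_scheme I A) (c b a : A)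
    (u : wg_hom C b a) (v : wg_hom C c b) :
  exists s, decomposes C c a (u \o v) s.
Proof.
have [s [sb su]] := hom_decomposes u; have [t [tc tv]] := hom_decomposes v.
by exists (s ++ t); rewrite /decomposes word_source_cat word_map_cat sb su tv.
Qed.

Definition hom_id (I A : finType) (C : cartan_scheme I A) (a : A) :
    wg_hom C a a :=
  @WgHom I A C a a id (ex_intro _ [::] (conj erefl erefl)).

Definition hom_comp (I A : finType) (C : cartan_scheme I A) (c b a : A)
    (u : wg_hom C b a) (v : wg_hom C c b) : wg_hom C c a :=
  WgHom (hom_comp_decomposes u v).

Lemma hom_inv_exists (I A : finType) (C : cartan_scheme I A) (b a : A)
    (u : wg_hom C b a) :
  exists v : wg_hom C a b,
    hom_comp u v = hom_id C a /\ hom_comp v u = hom_id C b.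
Proof.
have [s [sb su]] := hom_decomposes u.
have Hv : exists t, decomposes C a b (word_map C b (rev s)) t.
  by exists (rev s); split => //; rewrite -sb word_source_rev.
have [K1 K2] := word_map_rev C a s; rewrite sb su in K1 K2.
by exists (WgHom Hv); split; apply: hom_ext; apply: funext => x /=.
Qed.

Definition hom_inv (I A : finType) (C : cartan_scheme I A) (b a : A)
    (u : wg_hom C b a) : wg_hom C a b :=
  sval (cid (hom_inv_exists u)).

(** * Root systems *)

Section RootSets.
Local Open Scope classical_set_scope.
Local Open Scope card_scope.

Definition real_roots (I A : finType) (C : cartan_scheme I A) (a : A) :
    set (root_lattice I) :=
  [set x | exists s j, x = word_map C a s (alpha j)].

Definition positive_part (I : finType) (S : set (root_lattice I)) :
    set (root_lattice I) :=
  S `&` [set x | forall i, 0 <= x i].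

Definition rank_two_part (I : finType) (S : set (root_lattice I)) (i j : I) :
    set (root_lattice I) :=
  S `&` [set x | exists p q : nat, x = alpha i *+ p + alpha j *+ q].

(* In the last clause, [S #= `I_m] says that S is finite with m elements. *)
Definition is_root_system (I A : finType) (C : cartan_scheme I A)
    (R : A -> set (root_lattice I)) : Prop :=
  [/\ forall a,
        R a = positive_part (R a) `|` [set - x | x in positive_part (R a)],
      forall a i,
        R a `&` [set x | exists n : int, x = alpha i *~ n]
        = [set alpha i; - alpha i],
      forall a i, sigma C i a @` R a = R (rho C i a)
    & forall a i j m, i != j -> rank_two_part (R a) i j #= `I_m ->
        iter m (rho C i \o rho C j) a = a].

Definition is_finite_root_system (I A : finType) (C : cartan_scheme I A)
    (R : A -> set (root_lattice I)) : Prop :=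
  is_root_system C R /\ forall a, finite_set (R a).

End RootSets.

(** * Length, letters and weak order *)

Lemma decomposition_size_exists (I A : finType) (C : cartan_scheme I A)
    (b a : A) (w : wg_hom C b a) :
  exists k, `[< exists s, size s = k /\ decomposes C b a w s >].
Proof.
by have [s ws] := hom_decomposes w; exists (size s); apply/asboolP; exists s.
Qed.

Definition hom_length (I A : finType) (C : cartan_scheme I A) (b a : A)
    (w : wg_hom C b a) : nat :=
  ex_minn (decomposition_size_exists w).

Definition reduced (I A : finType) (C : cartan_scheme I A) (b a : A)
    (w : wg_hom C b a) (s : seq I) : Prop :=
  decomposes C b a w s /\ size s = hom_length w.

Lemma reduced_exists (I A : finType) (C : cartan_scheme I A) (b a : A)
    (w : wg_hom C b a) :
  exists s, reduced w s.
Proof.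
rewrite /reduced /hom_length; case: ex_minnP => k /asboolP[s [sk ws]] _.
by exists s.
Qed.

(* J(w), computed from an arbitrarily chosen reduced decomposition of w. *)
Definition letters (I A : finType) (C : cartan_scheme I A) (b a : A)
    (w : wg_hom C b a) : {set I} :=
  [set:: sval (cid (reduced_exists w))].

(* Elements of Hom(W(C), a) are pairs of a source and a morphism from it to a;
   the source is the implicit argument b, c, d or e below. *)
Definition weak_le (I A : finType) (C : cartan_scheme I A) (b c a : A)
    (u : wg_hom C b a) (w : wg_hom C c a) : Prop :=
  exists v : wg_hom C c b,
    w = hom_comp u v /\ (hom_length u + hom_length v)%N = hom_length w.

Definition is_meet (I A : finType) (C : cartan_scheme I A) (b c d a : A)
    (u : wg_hom C b a) (v : wg_hom C c a) (m : wg_hom C d a) : Prop :=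
  [/\ weak_le m u, weak_le m v
    & forall (e : A) (x : wg_hom C e a), weak_le x u -> weak_le x v ->
        weak_le x m].

(* Main.v *)
(* The set of inversions of a morphism w, i.e. the positive roots made negative
   by w^-1, is read off any reduced word of w, and J(w) is the union of the
   supports of these roots; hence J(w) is contained in the set of letters of
   every word for w. That minimal words have as many inversions as letters
   follows from an exchange property, which reduces to the rank two braid
   relations: the two alternating words that make all rank two positive roots
   negative have equal length by counting roots, equal source by (R4), and their
   quotient is an even word permuting the simple roots, hence trivial by a
   determinant argument.

   For the theorem let K = J(u^-1 v) and write u = x y with J(y) contained in K
   and x of minimal length. Then x sends the simple roots indexed by K to
   positive roots, so l(x z) = l(x) + l(z) for all z with letters in K. As
   v = x (y u^-1 v), x is a lower bound of u and v, whence J(x) is contained in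
   J(u /\ v) and J(u), J(v) in J(u /\ v) U K. The other inclusion is clear. *)

From HB Require Import structures.
Require Import Defs.
From mathcomp Require Import all_boot.
From mathcomp Require Import all_order all_algebra.
From mathcomp Require Import boolp classical_sets functions cardinality.
From mathcomp Require Import ring lra.

(** * The root lattice *)

Section Lattice.
Set Implicit Arguments.
Unset Strict Implicit.
Unset Printing Implicit Defensive.
Import Order.TTheory GRing.Theory Num.Theory.
Local Open Scope ring_scope.
Context {I : finType}.
Local Notation L := {ffun I -> int}.
Implicit Types (x y : L) (i j k : I) (K : {set I}).

Definition nonneg x : bool := [forall j, 0 <= x j].

Lemma nonnegP x : reflect (forall j, 0 <= x j) (nonneg x).
Proof. exact: forallP. Qed.

Definition supported x (K : {pred I}) : Prop := forall j, j \notin K -> x j = 0.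

Lemma lattice_expand x : x = \sum_j alpha j *~ x j.
Proof.
apply/ffunP => k; rewrite sum_ffunE (bigD1 k) //= big1 => [|j jk].
  by rewrite ffun_mulrzE ffunE eqxx mul1r addr0.
by rewrite ffun_mulrzE ffunE eq_sym (negPf jk) mul0r.
Qed.

Lemma additive_expand (f : {additive L -> L}) x :
  f x = \sum_j f (alpha j) *~ x j.
Proof.
by rewrite {1}[x]lattice_expand raddf_sum; apply: eq_bigr => j _; rewrite raddfMz.
Qed.

Lemma nonneg_alpha i : nonneg (alpha i).
Proof. by apply/nonnegP => j; rewrite ffunE; case: eqP. Qed.

Lemma nonneg_sum (F : I -> L) : (forall j, nonneg (F j)) -> nonneg (\sum_j F j).
Proof.
move=> Fp; apply/nonnegP => k; rewrite sum_ffunE sumr_ge0 // => j _.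
exact: (nonnegP _ (Fp j) k).
Qed.

Lemma nonneg_mulz x (n : int) : nonneg x -> 0 <= n -> nonneg (x *~ n).
Proof.
by move=> /nonnegP xp np; apply/nonnegP => k; rewrite ffun_mulrzE mulr_ge0.
Qed.

Lemma nonneg_opp_eq0 x : nonneg x -> nonneg (- x) -> x = 0.
Proof.
move=> /nonnegP xp /nonnegP xn; apply/ffunP => k; rewrite [RHS]ffunE.
by have := xn k; rewrite ffunE oppr_ge0 => xk; apply/eqP; rewrite eq_le xk xp.
Qed.

Lemma additive_nonneg (f : {additive L -> L}) (K : {pred I}) x :
  {in K, forall k, nonneg (f (alpha k))} -> nonneg x -> supported x K ->
  nonneg (f x).
Proof.
move=> fK /nonnegP xp xK; rewrite additive_expand; apply: nonneg_sum => j.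
have [jK|/xK ->] := boolP (j \in K); first exact: nonneg_mulz (fK j jK) (xp j).
by rewrite mulr0z; apply/nonnegP => k; rewrite ffunE.
Qed.

Lemma additive_nonpos (f : {additive L -> L}) (K : {pred I}) x :
  {in K, forall k, nonneg (- f (alpha k))} -> nonneg x -> supported x K ->
  nonneg (- f x).
Proof.
move=> fK /nonnegP xp xK; rewrite additive_expand -sumrN.
apply: nonneg_sum => j; rewrite -mulNrz.
have [jK|/xK ->] := boolP (j \in K); first exact: nonneg_mulz (fK j jK) (xp j).
by rewrite mulr0z; apply/nonnegP => k; rewrite ffunE.
Qed.

Lemma supported_alpha (K : {pred I}) i : i \in K -> supported (alpha i) K.
Proof. by move=> iK j; rewrite ffunE; case: eqP => // ->; rewrite iK. Qed.

Lemma alpha_neq0 i : alpha i != 0.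
Proof. by apply/eqP => /ffunP /(_ i); rewrite !ffunE eqxx. Qed.

Lemma nonneg_alphaN i : nonneg (- alpha i) = false.
Proof.
apply/negP => /(nonneg_opp_eq0 (nonneg_alpha i)) /eqP.
by rewrite (negPf (alpha_neq0 i)).
Qed.

Lemma nonneg_height x : nonneg x -> x != 0 -> 1 <= \sum_j x j.
Proof.
move=> /nonnegP xp /eqP x0; rewrite -gtz0_ge1 lt0r sumr_ge0 // andbT.
apply/eqP => s0; apply: x0; apply/ffunP => k; rewrite [RHS]ffunE.
apply/eqP; move/eqP: s0; rewrite psumr_eq0 // => /allP; apply.
by rewrite mem_index_enum.
Qed.

(** The coordinates are integers, so a single nonzero one already exhausts the height. *)
Lemma height_le1 x : nonneg x -> x != 0 -> \sum_j x j <= 1 ->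
  exists j, x = alpha j.
Proof.
move=> xp x0 h1; have /existsP[j xj] : [exists j, x j != 0].
  apply: contraNT x0 => /existsPn x0; apply/eqP/ffunP => j.
  by rewrite [RHS]ffunE; apply/eqP; have := x0 j; rewrite negbK.
move/nonnegP: (xp) => xp'.
have xj1 : 1 <= x j by rewrite -gtz0_ge1 lt0r xj xp'.
exists j; apply/ffunP => k; rewrite ffunE; move: h1; rewrite (bigD1 j) //=.
case: eqP => [->|/eqP kj].
  have : 0 <= \sum_(i | i != j) x i by apply: sumr_ge0.
  by rewrite mulr1n; lra.
rewrite (bigD1 k) //=.
have : 0 <= \sum_(i | (i != j) && (i != k)) x i by apply: sumr_ge0.
have := xp' k; rewrite mulr0n; lra.
Qed.

End Lattice.

(** * Words and their inversions *)

Section Words.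
Set Implicit Arguments.
Unset Strict Implicit.
Unset Printing Implicit Defensive.
Import Order.TTheory GRing.Theory Num.Theory.
Local Open Scope ring_scope.
Context {I A : finType} (C : cartan_scheme I A).
Local Notation L := {ffun I -> int}.
Implicit Types (x y : L) (i j k : I) (a b : A) (s t : seq I).

(** The inverse gets its own recursion, based at the target [a] and applying the letters from left
    to right; [word_inv_rev] identifies it with the map of the reversed word. *)
Fixpoint word_inv a s : L -> L :=
  if s is i :: s' then word_inv (rho C i a) s' \o sigma C i a else id.

Lemma sigmaKV i a : cancel (sigma C i (rho C i a)) (sigma C i a).
Proof. by move=> x; have := sigmaK C i (rho C i a) x; rewrite rho_involutive. Qed.

Lemma word_mapK a s : cancel (word_map C a s) (word_inv a s).
Proof. by elim: s a => //= i s IH a x /=; rewrite sigmaKV IH. Qed.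

Lemma word_invK a s : cancel (word_inv a s) (word_map C a s).
Proof. by elim: s a => //= i s IH a x /=; rewrite IH sigmaK. Qed.

Lemma word_inv_rev a s : word_map C (word_source C a s) (rev s) = word_inv a s.
Proof.
apply: funext => x; have [_ K] := word_map_rev C a s.
by rewrite -{1}[x](word_invK a s) K.
Qed.

Lemma word_inv_cat a s t :
  word_inv a (s ++ t) = word_inv (word_source C a s) t \o word_inv a s.
Proof. by elim: s a => //= i s IH a; rewrite IH. Qed.

(** * Additivity and action on coordinates *)

Fact sigma_is_zmod_morphism i a : zmod_morphism (sigma C i a).
Proof.
have sigmaN x : sigma C i a (- x) = - sigma C i a x.
  apply/eqP; rewrite -addr_eq0 -sigma_additive addNr /sigma big1 ?mulr0z ?subr0 //.
  by move=> j _; rewrite ffunE mulr0.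
by move=> x y; rewrite sigma_additive sigmaN.
Qed.
HB.instance Definition _ i a :=
  GRing.isZmodMorphism.Build L L (sigma C i a) (sigma_is_zmod_morphism i a).

Fact word_map_is_zmod_morphism a s : zmod_morphism (word_map C a s).
Proof. by elim: s a => //= i s IH a x y /=; rewrite IH raddfB. Qed.
HB.instance Definition _ a s :=
  GRing.isZmodMorphism.Build L L (word_map C a s) (word_map_is_zmod_morphism a s).

Fact word_inv_is_zmod_morphism a s : zmod_morphism (word_inv a s).
Proof. by elim: s a => //= i s IH a x y /=; rewrite raddfB IH. Qed.
HB.instance Definition _ a s :=
  GRing.isZmodMorphism.Build L L (word_inv a s) (word_inv_is_zmod_morphism a s).

Lemma sigmaN i a x : sigma C i a (- x) = - sigma C i a x.
Proof. exact: raddfN. Qed.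

Lemma word_mapN a s x : word_map C a s (- x) = - word_map C a s x.
Proof. exact: raddfN. Qed.

Lemma word_invN a s x : word_inv a s (- x) = - word_inv a s x.
Proof. exact: raddfN. Qed.

Lemma sigma_simple i a : sigma C i a (alpha i) = - alpha i.
Proof.
have [c2 _ _] := cartan_gcm C a.
by rewrite sigma_alpha c2 -[2]/(Posz 2) -pmulrn mulr2n opprD addrA subrr add0r.
Qed.

Lemma sigma_coord i j a x : j != i -> sigma C i a x j = x j.
Proof.
by move=> ji; rewrite /sigma !ffunE ffun_mulrzE ffunE (negPf ji) mul0r subr0.
Qed.

Lemma word_map_coord a s x j : j \notin s -> word_map C a s x j = x j.
Proof.
elim: s a => //= i s IH a; rewrite inE negb_or => /andP[ji js].
by rewrite sigma_coord // IH.
Qed.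

Lemma word_inv_coord a s x j : j \notin s -> word_inv a s x j = x j.
Proof. by move=> js; rewrite -word_inv_rev word_map_coord ?mem_rev. Qed.

Lemma word_map_supported (K : {pred I}) a s x :
  {subset s <= K} -> supported x K -> supported (word_map C a s x) K.
Proof.
move=> sK xK j jK; rewrite word_map_coord ?xK //.
by apply: contra jK; apply: sK.
Qed.

Lemma word_inv_supported (K : {pred I}) a s x :
  {subset s <= K} -> supported x K -> supported (word_inv a s x) K.
Proof.
move=> sK xK j jK; rewrite word_inv_coord ?xK //.
by apply: contra jK; apply: sK.
Qed.

(** * Words for the same morphism and minimal words *)

Definition same_morphism a s t : Prop :=
  word_source C a s = word_source C a t /\ word_map C a s = word_map C a t.

Lemma same_refl a s : same_morphism a s s. Proof. by []. Qed.

Lemma same_sym a s t : same_morphism a s t -> same_morphism a t s.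
Proof. by case. Qed.

Lemma same_trans a s t r :
  same_morphism a s t -> same_morphism a t r -> same_morphism a s r.
Proof. by case=> st1 st2 [tr1 tr2]; split; rewrite (st1, st2) (tr1, tr2). Qed.

Lemma same_inv a s t : same_morphism a s t -> word_inv a s = word_inv a t.
Proof.
move=> [_ st]; apply: funext => x.
by rewrite -{1}[x](word_invK a t) -st word_mapK.
Qed.

Lemma same_cat a s s' t t' : same_morphism a s s' ->
  same_morphism (word_source C a s) t t' -> same_morphism a (s ++ t) (s' ++ t').
Proof.
move=> [ss sm] [ts tm]; split; first by rewrite !word_source_cat -ss ts.
by rewrite !word_map_cat -ss sm tm.
Qed.

Lemma same_cons a i s t :
  same_morphism (rho C i a) s t -> same_morphism a (i :: s) (i :: t).
Proof. exact: (@same_cat a [:: i] [:: i]). Qed.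

Lemma same_cancel a i s : same_morphism a [:: i, i & s] s.
Proof.
split; rewrite /= rho_involutive //; apply: funext => x /=.
by rewrite sigmaK.
Qed.

Lemma same_rev a s t :
  same_morphism a s t -> same_morphism (word_source C a s) (rev s) (rev t).
Proof.
move=> st; have [ss _] := st; split.
  by rewrite word_source_rev ss word_source_rev.
by rewrite word_inv_rev ss word_inv_rev (same_inv st).
Qed.

(** Reducedness phrased for words with target [a], so that the combinatorics avoids the dependent
    types of morphisms; [reducedE] translates back. *)
Definition shortest a s : Prop :=
  forall t, same_morphism a s t -> (size s <= size t)%N.

Lemma shortest_exists a s : exists2 t, same_morphism a s t & shortest a t.
Proof.
have [n] := ubnP (size s); elim: n s => // n IH s.
rewrite ltnS => sn; have [ls|] := pselect (shortest a s); first by exists s.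
move/existsNP => [t] /not_implyP[st /negP]; rewrite -ltnNge => ts.
have [r tr lr] := IH t (leq_trans ts sn).
by exists r => //; apply: same_trans st tr.
Qed.

Lemma shortest_same a s t : shortest a s -> same_morphism a s t ->
  size t = size s -> shortest a t.
Proof.
by move=> ls st ts r tr; rewrite ts; apply: ls; apply: same_trans st tr.
Qed.

Lemma shortest_catl a s t : shortest a (s ++ t) -> shortest a s.
Proof.
move=> lst r sr; have := lst (r ++ t); rewrite !size_cat leq_add2r; apply.
exact: same_cat sr (same_refl _ _).
Qed.

Lemma shortest_catr a s t : shortest a (s ++ t) -> shortest (word_source C a s) t.
Proof.
move=> lst r tr; have := lst (s ++ r); rewrite !size_cat leq_add2l; apply.
exact: same_cat (same_refl _ _) tr.
Qed.

Lemma shortest_cons a i s : shortest a (i :: s) -> shortest (rho C i a) s.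
Proof. exact: (@shortest_catr a [:: i]). Qed.

Lemma shortest_rev a s : shortest a s -> shortest (word_source C a s) (rev s).
Proof.
move=> ls t st; rewrite size_rev -(size_rev t); apply: ls.
by have := same_rev st; rewrite word_source_rev revK.
Qed.

Lemma shortest_head a i j s : shortest a [:: i, j & s] -> i != j.
Proof.
move=> ls; apply/eqP => ij; subst j.
by have := ls _ (same_cancel a i s); rewrite /= ltnNge leqnSn.
Qed.

(* The candidates for the positive roots made negative by the inverse of the
   morphism: prefix(alpha_i) for every letter i of the word. *)
Fixpoint inversions a s : seq L :=
  if s is i :: s' then
    alpha i :: [seq sigma C i (rho C i a) y | y <- inversions (rho C i a) s']
  else [::].

(** All candidates are really positive. In a root system this amounts to minimality, by
    [good_shortest] and [shortest_good]. *)
Definition good a s : bool := all (@nonneg I) (inversions a s).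

Lemma size_inversions a s : size (inversions a s) = size s.
Proof. by elim: s a => //= i s IH a; rewrite size_map IH. Qed.

Lemma inversions_cat a s t :
  inversions a (s ++ t) =
  inversions a s ++
  [seq word_map C a s y | y <- inversions (word_source C a s) t].
Proof.
elim: s a => [|i s IH] a /=; first by rewrite map_id.
by rewrite IH map_cat -map_comp.
Qed.

Lemma inversions_rcons a s i :
  inversions a (rcons s i) = rcons (inversions a s) (word_map C a s (alpha i)).
Proof. by rewrite -cats1 inversions_cat /= cats1. Qed.

Lemma good_rcons a s i :
  good a (rcons s i) = nonneg (word_map C a s (alpha i)) && good a s.
Proof. by rewrite /good inversions_rcons all_rcons. Qed.

(** The head [alpha i] accounts for the letter [i]; at any other letter [j] the reflection at [i]
    leaves coordinate [j] unchanged, so the tail decides. *)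
Lemma inversions_support a s j :
  (j \in s) = has (fun y => y j != 0) (inversions a s).
Proof.
elim: s a => //= i s IH a; rewrite inE ffunE has_map.
have [->|ji] //= := eqVneq j i; rewrite (IH (rho C i a)).
by apply: eq_has => y /=; rewrite sigma_coord.
Qed.

Lemma inversions_nonzero a s j :
  j \in s -> exists2 y, y \in inversions a s & y j != 0.
Proof. by rewrite (inversions_support a) => /hasP. Qed.

Lemma inversions_supported a s y :
  y \in inversions a s -> supported y (mem s).
Proof.
move=> ys j js; apply/eqP; apply: contraNT js => yj.
by rewrite -[_ \in _]/(j \in s) (inversions_support a); apply/hasP; exists y.
Qed.

End Words.

(** * Good words in a root system *)

Section Roots.
Set Implicit Arguments.
Unset Strict Implicit.
Unset Printing Implicit Defensive.
Import Order.TTheory GRing.Theory Num.Theory.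
Local Open Scope ring_scope.
Context {I A : finType} (C : cartan_scheme I A).
Hypothesis rootC : is_root_system C (real_roots C).
Local Notation L := {ffun I -> int}.
Local Notation R := (real_roots C).
Local Notation word_inv := (word_inv C).
Local Notation inversions := (inversions C).
Local Notation good := (good C).
Local Notation shortest := (shortest C).
Local Notation same_morphism := (same_morphism C).
Implicit Types (x y : L) (i j k : I) (a b : A) (s t : seq I).

Lemma root_alpha a i : R a (alpha i).
Proof. by exists [::], i. Qed.

Lemma root_word_map a s x : R (word_source C a s) x -> R a (word_map C a s x).
Proof. by move=> [t [j ->]]; exists (s ++ t), j; rewrite word_map_cat. Qed.

Lemma root_word_inv a s x : R a x -> R (word_source C a s) (word_inv a s x).
Proof.
move=> Rx; rewrite -word_inv_rev; apply: root_word_map.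
by rewrite word_source_rev.
Qed.

Lemma root_sigma a i x : R a x -> R (rho C i a) (sigma C i a x).
Proof. exact: (@root_word_inv a [:: i]). Qed.

Lemma root_opp a x : R a x -> R a (- x).
Proof.
move=> [t [j ->]]; exists (rcons t j), j.
by rewrite -cats1 word_map_cat /= sigma_simple word_mapN.
Qed.

Lemma root_neq0 a x : R a x -> x != 0.
Proof.
move=> [t [j ->]]; apply/eqP => /(congr1 (word_inv a t)) /eqP.
by rewrite word_mapK raddf0 (negPf (alpha_neq0 j)).
Qed.

Lemma root_nonnegN a x : R a x -> nonneg (- x) = ~~ nonneg x.
Proof.
have [R1 _ _ _] := rootC; move=> Rx; have x0 := root_neq0 Rx.
have : nonneg x || nonneg (- x).
  rewrite R1 in Rx; case: Rx => [[_ /nonnegP ->] //|[y [_ /nonnegP yp] <-]].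
  by rewrite opprK yp orbT.
have [xp _|_ /= -> //] := boolP (nonneg x).
by apply: contraNF x0 => /(nonneg_opp_eq0 xp) ->.
Qed.

(** By (R1) the coordinates of a root share one sign, so one positive coordinate settles it. *)
Lemma root_nonneg_coord a x j : R a x -> 0 < x j -> nonneg x.
Proof.
move=> Rx xj; apply: contraLR xj; rewrite -(root_nonnegN Rx) -leNgt.
by move=> /nonnegP /(_ j); rewrite ffunE oppr_ge0.
Qed.

(** By (R2) a positive root other than [alpha i] has a positive coordinate away from [i], and the
    reflection at [i] does not change it. *)
Lemma root_sigma_nonneg a i x :
  R a x -> nonneg x -> x != alpha i -> nonneg (sigma C i a x).
Proof.
move=> Rx xp xi.
have /existsP[j /andP[ji xj]] : [exists j, (j != i) && (x j != 0)].
  apply: contraNT xi => /existsPn x0.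
  have xE : x = alpha i *~ x i.
    apply/ffunP => j; rewrite ffun_mulrzE ffunE.
    have [-> | ji] := eqVneq j i; first by rewrite mul1r.
    by have := x0 j; rewrite ji negbK mul0r => /eqP.
  have [_ R2 _ _] := rootC.
  have : (R a `&` [set x | exists n : int, x = alpha i *~ n])%classic x.
    by split=> //; exists (x i).
  by rewrite R2 => -[-> //|xN]; move: xp; rewrite xN nonneg_alphaN.
apply: (@root_nonneg_coord (rho C i a) _ j); first exact: root_sigma.
by rewrite sigma_coord // lt0r xj; apply/nonnegP.
Qed.

(** * Inversions of good words *)

Lemma root_inversions a s x : x \in inversions a s -> R a x.
Proof.
elim: s a x => //= i s IH a x; rewrite inE => /predU1P[-> |/mapP[y ys ->]].
  exact: root_alpha.
by apply: (@root_word_map a [:: i]); apply: IH.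
Qed.

(** When the letters are applied one at a time, a positive root can turn negative only at the moment
    it equals the simple root of the current letter. *)
Lemma mem_inversions a s x : R a x -> nonneg x ->
  ~~ nonneg (word_inv a s x) -> x \in inversions a s.
Proof.
elim: s a x => [|i s IH] a x Rx xp /=; first by rewrite xp.
have [-> _|xi xn] := eqVneq x (alpha i); first by rewrite inE eqxx.
rewrite inE; apply/orP; right; apply/mapP; exists (sigma C i a x).
  by apply: IH xn; [apply: root_sigma | apply: root_sigma_nonneg].
by rewrite sigmaK.
Qed.

(** Induction on the last letter [i]: it could make an older inversion [x] positive again only if
    [x] were the negative of the newest inversion, but both are positive. *)
Lemma good_inversions a s x : good a s -> x \in inversions a s ->
  ~~ nonneg (word_inv a s x).
Proof.
elim/last_ind: s x => // s i IH x gsi; move: (gsi).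
rewrite good_rcons inversions_rcons mem_rcons -cats1 word_inv_cat /= => /andP[ip gs].
rewrite inE => /predU1P[-> |xs].
  by rewrite word_mapK sigma_simple nonneg_alphaN.
have Rx := root_inversions xs; have Rsx := root_word_inv s Rx.
apply/negP => snx; have sx := IH x gs xs; move: (sx).
rewrite -(root_nonnegN Rsx) => sxp.
have [siE|sni] := eqVneq (- word_inv a s x) (alpha i).
  have xE : x = - word_map C a s (alpha i).
    by rewrite -siE word_mapN word_invK opprK.
  have := allP gs _ xs.
  by rewrite xE (root_nonnegN (root_word_map (root_alpha _ i))) ip.
have := root_sigma_nonneg (root_opp Rsx) sxp sni.
by rewrite sigmaN (root_nonnegN (root_sigma _ Rsx)) snx.
Qed.

Lemma uniq_inversions a s : good a s -> uniq (inversions a s).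
Proof.
elim/last_ind: s => // s i IH; rewrite good_rcons inversions_rcons rcons_uniq.
move=> /andP[ip gs]; rewrite IH // andbT; apply/negP => /(good_inversions gs).
by rewrite word_mapK nonneg_alpha.
Qed.

(** The distinct inversions of [s] are positive roots made negative by the common inverse map, hence
    all occur among the candidates of [t]. *)
Lemma good_size a s t : good a s -> same_morphism a s t -> (size s <= size t)%N.
Proof.
move=> gs st; rewrite -(size_inversions C a s) -(size_inversions C a t).
apply: uniq_leq_size (uniq_inversions gs) _ => x xs.
apply: mem_inversions (root_inversions xs) (allP gs _ xs) _.
by rewrite -(same_inv st); apply: good_inversions.
Qed.

Lemma good_shortest a s : good a s -> shortest a s.
Proof. by move=> gs t; apply: good_size. Qed.

(** Some inversion [x] of [s] has positive coordinate [i]. If [i] were missing from [t], the inverse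
    map would keep that coordinate and so keep [x] positive. *)
Lemma good_letters a s t : good a s -> same_morphism a s t -> {subset s <= t}.
Proof.
move=> gs st i /(inversions_nonzero C a)[x xs xi].
have Rx := root_inversions xs.
apply: contraNT (good_inversions gs xs) => it; rewrite (same_inv st).
apply: (root_nonneg_coord (root_word_inv t Rx) (j := i)).
by rewrite word_inv_coord // lt0r xi; apply/nonnegP; apply: (allP gs).
Qed.

Lemma good_cons a i s :
  good (rho C i a) s -> nonneg (word_inv (rho C i a) s (alpha i)) ->
  good a (i :: s).
Proof.
move=> gs ip; rewrite /good /= nonneg_alpha; apply/allP => _ /mapP[y ys ->].
have Ry := root_inversions ys.
apply: root_sigma_nonneg => //; first exact: (allP gs).
by apply: contraTneq ys => ->; apply/negP => /(good_inversions gs); rewrite ip.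
Qed.

(** An inversion of [t] supported in [K] would stay positive under the inverse of [t]. So every
    inversion of [t] has a positive coordinate outside [K], which [s] leaves unchanged. *)
Lemma good_cat (K : {pred I}) a s t : good a s -> {subset s <= K} ->
  good (word_source C a s) t ->
  {in K, forall k, nonneg (word_inv (word_source C a s) t (alpha k))} ->
  good a (s ++ t).
Proof.
move=> gs sK gt Kt; rewrite /good inversions_cat all_cat; apply/andP; split=> //.
apply/allP => _ /mapP[y yt ->]; have yp := allP gt _ yt.
have /existsP[j /andP[jK yj]] : [exists j, (j \notin K) && (y j != 0)].
  apply: contraT => /existsPn y0; have := good_inversions gt yt.
  suff -> : nonneg (word_inv (word_source C a s) t y) by [].
  apply: (additive_nonneg Kt yp) => j jK.
  by apply/eqP; have := y0 j; rewrite jK negbK.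
apply: (root_nonneg_coord (root_word_map (root_inversions yt)) (j := j)).
rewrite word_map_coord; last by apply: contra jK; apply: sK.
by rewrite lt0r yj; apply/nonnegP.
Qed.

End Roots.

(** * Braid relations *)

Section RankTwo.
Set Implicit Arguments.
Unset Strict Implicit.
Unset Printing Implicit Defensive.
Import Order.TTheory GRing.Theory Num.Theory.
Local Open Scope ring_scope.
Context {I A : finType} (C : cartan_scheme I A).
Hypothesis rootC : is_root_system C (real_roots C).
Local Notation L := {ffun I -> int}.
Local Notation R := (real_roots C).
Local Notation word_inv := (word_inv C).
Local Notation inversions := (inversions C).
Local Notation good := (good C).
Local Notation shortest := (shortest C).
Local Notation same_morphism := (same_morphism C).
Implicit Types (x y : L) (i j k l : I) (a b : A) (s t q : seq I) (n p : nat).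

(** * Alternating words *)

Fixpoint alternating i k n : seq I :=
  if n is n'.+1 then i :: alternating k i n' else [::].

Lemma size_alternating i k n : size (alternating i k n) = n.
Proof. by elim: n i k => //= n IH i k; rewrite IH. Qed.

Lemma alternating_rcons i k n :
  alternating i k n.+1 = rcons (alternating i k n) (if odd n then k else i).
Proof.
elim: n i k => // n IH i k; rewrite -[LHS]/(i :: alternating k i n.+1) IH /=.
by case: (odd n).
Qed.

Lemma alternating_cat i k n p :
  alternating i k (n + p) = alternating i k n ++
    (if odd n then alternating k i p else alternating i k p).
Proof. by elim: n i k => //= n IH i k; rewrite IH; case: (odd n). Qed.

Lemma rev_alternating i k n :
  rev (alternating i k n) =
  if odd n then alternating i k n else alternating k i n.
Proof.
elim: n i k => //= n IH i k; rewrite rev_cons IH.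
have := alternating_rcons i k n; have := alternating_rcons k i n.
by case: (odd n) => eki eik; [apply: esym eki | apply: esym eik].
Qed.

Lemma alternating_sub i k n : {subset alternating i k n <= pred2 i k}.
Proof.
elim: n i k => // n IH i k l; rewrite inE => /predU1P[->|/IH].
  by rewrite inE eqxx.
by rewrite !inE orbC.
Qed.

Lemma word_source_alternating a i k n :
  word_source C a (alternating i k n.*2) = iter n (rho C k \o rho C i) a.
Proof. by elim: n a => // n IH a; rewrite iterSr -IH. Qed.

(** Equal neighbouring letters would cancel. *)
Lemma shortest_alternating a i k s :
  shortest a (i :: s) -> {subset i :: s <= pred2 i k} ->
  i :: s = alternating i k (size s).+1.
Proof.
elim: s a i k => //= j s IH a i k ls sub; congr cons.
have ij := shortest_head ls.
have /predU1P[ji|/eqP jk] : j \in pred2 i k by apply: sub; rewrite !inE eqxx orbT.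
  by rewrite ji eqxx in ij.
subst j; apply: (IH _ _ i (shortest_cons ls)) => l ls'.
by rewrite !inE orbC; apply: (sub l); rewrite inE ls' orbT.
Qed.

(** * Longest words in two letters *)

Lemma root_negative_span a s x (K : {pred I}) : R a x -> nonneg x ->
  supported x K -> {in K, forall k, ~~ nonneg (word_inv a s (alpha k))} ->
  ~~ nonneg (word_inv a s x).
Proof.
move=> Rx xp xK neg; rewrite -(root_nonnegN rootC (root_word_inv s Rx)).
apply: (additive_nonpos _ xp xK) => k kK.
by rewrite (root_nonnegN rootC (root_word_inv s (root_alpha _ _ k))) neg.
Qed.

(** Words for the longest element of rank two, characterised by signs of roots instead of length. *)
Definition longest i k a q : Prop :=
  [/\ good a q, {subset q <= pred2 i k}
    & {in pred2 i k, forall l, ~~ nonneg (word_inv a q (alpha l))}].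

Lemma longestC i k a q : longest i k a q -> longest k i a q.
Proof.
have ikC l : (l \in pred2 k i) = (l \in pred2 i k) by rewrite !inE orbC.
by case=> gq sq nq; split=> // l; rewrite ikC; [apply: sq | apply: nq].
Qed.

Lemma good_rank_two i k a q x : good a q -> {subset q <= pred2 i k} ->
  x \in inversions a q -> nonneg x /\ supported x (pred2 i k).
Proof.
move=> gq sq xq; split; first exact: (allP gq).
move=> j jik; apply: (inversions_supported xq).
by apply: contra jik; apply: sq.
Qed.

(** The criterion does not involve [q], so all longest words at [a] have the same inversions. *)
Lemma longest_inversions i k a q x : longest i k a q -> R a x ->
  x \in inversions a q <-> nonneg x /\ supported x (pred2 i k).
Proof.
move=> [gq sq nq] Rx; split; first exact: good_rank_two.
by move=> [xp xik]; apply: mem_inversions => //; apply: root_negative_span nq.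
Qed.

Lemma longest_mem i k a q l :
  longest i k a q -> l \in pred2 i k -> alpha l \in inversions a q.
Proof.
move=> lq lik; apply/(longest_inversions lq (root_alpha _ _ _)).
by split; [apply: nonneg_alpha | apply: supported_alpha].
Qed.

Lemma longest_size i k a q q' :
  longest i k a q -> longest i k a q' -> size q = size q'.
Proof.
move=> lq lq'; have [gq _ _] := lq; have [gq' _ _] := lq'.
rewrite -(size_inversions C a q) -(size_inversions C a q').
apply/perm_size/uniq_perm; try exact: uniq_inversions.
move=> x; apply/idP/idP => xq; have Rx := root_inversions xq.
  by apply/(longest_inversions lq' Rx); apply/(longest_inversions lq Rx).
by apply/(longest_inversions lq Rx); apply/(longest_inversions lq' Rx).
Qed.

(** Supplies the exponent in (R4): the inversions of [q] list the rank two positive roots without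
    repetition. *)
Lemma longest_card i k a q : i != k -> longest i k a q ->
  (rank_two_part (R a) i k #= `I_(size q))%card.
Proof.
move=> ik lq; have [gq _ _] := lq.
have uq := uniq_inversions rootC gq.
rewrite -(size_inversions C a q); set s := inversions a q.
have -> : rank_two_part (R a) i k = (nth 0 s @` `I_(size s))%classic.
  apply/seteqP; split=> x /=.
    move=> [Rx [m [n xE]]].
    have xs : x \in s.
      apply/(longest_inversions lq Rx); split.
        apply/nonnegP => l; rewrite xE ffunE !ffunMnE !ffunE.
        by rewrite addr_ge0 // mulrn_wge0.
      move=> l; rewrite !inE negb_or => /andP[li lk].
      by rewrite xE ffunE !ffunMnE !ffunE (negPf li) (negPf lk) !mul0rn addr0.
    by exists (index x s); rewrite ?nth_index //= index_mem.
  move=> [m ms <-]; move: (mem_nth 0 ms) => {ms}; move: (nth 0 s m) => {}x xs.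
  have Rx := root_inversions xs.
  have [/nonnegP xp xik] := (longest_inversions lq Rx).1 xs.
  split=> //; exists `|x i|%N, `|x k|%N; apply/ffunP => l.
  have coefE (e : bool) (z : int) : 0 <= z -> e%:R *+ `|z|%N = e%:R * z.
    by move=> z0; rewrite -[LHS]mulr_natr (natz `|z|%N) gez0_abs.
  rewrite ffunE !ffunMnE !ffunE !coefE //.
  have [->|li] := eqVneq l i; first by rewrite (negPf ik) mul1r mul0r addr0.
  have [->|lk] := eqVneq l k; first by rewrite mul1r mul0r add0r.
  by rewrite !mul0r addr0 xik // !inE negb_or li lk.
apply: inj_card_eq => m n; rewrite !inE /= => ms ns /eqP.
by rewrite nth_uniq // => /eqP.
Qed.

(** If the inverse kept [alpha l] positive, mapping back would give a nonpositive vector, yet it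
    gives [alpha l]. *)
Lemma word_map_longest i k a s : good a s -> {subset s <= pred2 i k} ->
  {in pred2 i k, forall l, ~~ nonneg (word_map C a s (alpha l))} ->
  longest i k a s.
Proof.
move=> gs sub neg; split=> // l lik; apply/negP => lp.
have : nonneg (- word_map C a s (word_inv a s (alpha l))).
  apply: (additive_nonpos (K := pred2 i k)) lp _.
    move=> h hik; rewrite (root_nonnegN rootC (a := a)) ?neg //.
    exact/root_word_map/root_alpha.
  exact: word_inv_supported sub (supported_alpha lik).
by rewrite word_invK nonneg_alphaN.
Qed.

(** If the next letter of an alternating word failed to give a positive root, the word so far would
    make both simple roots negative. It would then be longest, although shorter than [q]. *)
Lemma good_alternating i k a q p :
  longest i k a q -> (p <= size q)%N -> good a (alternating i k p).
Proof.
move=> lq; elim: p => // p IH pq; rewrite alternating_rcons good_rcons.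
rewrite IH ?andbT 1?ltnW //; have {IH} gp := IH (ltnW pq).
case: p => [|p] in pq gp *; first by rewrite nonneg_alpha.
move: (gp); rewrite {1}alternating_rcons good_rcons => /andP[zp _].
set s := alternating i k p.+1 in gp *.
(* This index is the last letter of [s]; its simple root goes to the negative of the last
   inversion. *)
have zn : ~~ nonneg (word_map C a s (alpha (if odd p then k else i))).
  have Rz := root_word_map (root_alpha C (word_source C a (alternating i k p))
    (if odd p then k else i)).
  rewrite /s alternating_rcons -cats1 word_map_cat /= sigma_simple word_mapN.
  by rewrite (root_nonnegN rootC Rz) zp.
apply: contraT => xn.
have ls : longest i k a s.
  apply: word_map_longest gp (@alternating_sub _ _ _) _ => l.
  by move: xn zn; rewrite /=; case: (odd p) => /= xn zn /pred2P[]->.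
by have := longest_size lq ls; rewrite size_alternating => qp; rewrite qp ltnn in pq.
Qed.

(** The alternating word is good, and its inversions lie among those of [q]. Both lists have the
    same size, so they have the same members, simple roots included. *)
Lemma longest_alternating i k a q :
  longest i k a q -> longest i k a (alternating i k (size q)).
Proof.
move=> lq; have [gq _ _] := lq; have gs := good_alternating lq (leqnn _).
split=> // [|l lik]; first exact: alternating_sub.
apply: (good_inversions rootC gs).
have us := uniq_inversions rootC gs.
have [|/= |_ ->] := @uniq_min_size _ _ (inversions a q) us;
  last exact: longest_mem lik.
  move=> x xs; apply/(longest_inversions lq (root_inversions xs)).
  exact: good_rank_two gs (@alternating_sub _ _ _) xs.
by rewrite !size_inversions size_alternating.
Qed.

(** By (R4) the alternating loop of twice this length returns to [a]. Its second half is the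
    reversal of the other alternating word, so both words lead to the midpoint. *)
Lemma longest_source i k a q : i != k -> longest i k a q ->
  word_source C a (alternating i k (size q)) =
  word_source C a (alternating k i (size q)).
Proof.
move=> ik lq; have [_ _ _ R4] := rootC; set n := size q.
have := R4 a i k n ik (longest_card ik lq).
rewrite -word_source_alternating -addnn alternating_cat word_source_cat.
have -> : (if odd n then alternating i k n else alternating k i n)
  = rev (alternating i k n) by rewrite rev_alternating.
set t := alternating i k n; set b := word_source C a (alternating k i n) => E.
by rewrite -[RHS](word_source_rev C _ (rev t)) E revK.
Qed.

(** * Words permuting the simple roots *)

Lemma word_map_simple a s :
  (forall l, nonneg (word_map C a s (alpha l))) ->
  forall l, exists j, word_map C a s (alpha l) = alpha j.
Proof.
move=> ps l; have Rw := root_word_map (root_alpha C (word_source C a s) l).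
(* The inverse preserves positivity too: a negative value would be mapped back to a nonpositive
   vector. *)
have pv j : nonneg (word_inv a s (alpha j)).
  have Rv := root_word_inv s (root_alpha C a j).
  apply: contraT; rewrite -(root_nonnegN rootC Rv) => vn.
  have := additive_nonneg (f := word_map C a s) (K := predT) (fun j _ => ps j) vn.
  by rewrite /= word_mapN word_invK nonneg_alphaN; apply.
(* Heights do not decrease under the inverse, which sends each simple root to a vector of height at
   least one; and it sends the image back to [alpha l], of height one. *)
apply: height_le1 => //; first exact: (root_neq0 Rw).
set x := word_map C a s (alpha l).
have <- : \sum_j (alpha l : L) j = 1.
  rewrite (bigD1 l) //= ffunE eqxx big1 ?addr0 // => j jl.
  by rewrite ffunE (negPf jl).
have -> : alpha l = word_inv a s x by rewrite word_mapK.
rewrite (additive_expand (word_inv a s)).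
under [leRHS]eq_bigr do rewrite sum_ffunE.
rewrite exchange_big /=; apply: ler_sum => j _.
under eq_bigr do rewrite ffun_mulrzE.
rewrite -mulr_suml ler_peMl //; first exact: (nonnegP _ (ps l)).
exact: nonneg_height (pv j) (root_neq0 (root_word_inv s (root_alpha C a j))).
Qed.

(** Determinant in the coordinates [i] and [k]. Each reflection at [i] or [k] reverses its sign on
    vectors supported there, so it detects the parity of a word. *)
Definition minor2 i k x y : int := x i * y k - x k * y i.

Lemma sigma_minor2 i k l a x y : i != k -> l \in pred2 i k ->
  supported x (pred2 i k) -> supported y (pred2 i k) ->
  minor2 i k (sigma C l a x) (sigma C l a y) = - minor2 i k x y.
Proof.
move=> ik lik xs ys.
have [c2 _ _] := cartan_gcm C a.
have sumE z : supported z (pred2 i k) ->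
    \sum_j cartan C a l j * z j = cartan C a l i * z i + cartan C a l k * z k.
  move=> zs; rewrite (bigD1 i) //= (bigD1 k) 1?eq_sym //= big1 ?addr0 //.
  by move=> j /andP[ji jk]; rewrite zs ?mulr0 // !inE negb_or ji.
have sE z h : sigma C l a z h = z h - (h == l)%:R * \sum_j cartan C a l j * z j.
  by rewrite /sigma !ffunE ffun_mulrzE ffunE.
rewrite /minor2 !sE !sumE //.
case/pred2P: lik => ->; rewrite !eqxx c2.
  by rewrite [k == i]eq_sym (negPf ik) mulr1n mulr0n; ring.
by rewrite (negPf ik) mulr1n mulr0n; ring.
Qed.

Lemma word_map_minor2 i k a s x y : i != k -> {subset s <= pred2 i k} ->
  supported x (pred2 i k) -> supported y (pred2 i k) ->
  minor2 i k (word_map C a s x) (word_map C a s y) =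
  (-1) ^+ size s * minor2 i k x y.
Proof.
move=> ik; elim: s a => [|l s IH] a sub xs ys /=; first by rewrite mul1r.
have sub' : {subset s <= pred2 i k} by move=> h hs; apply: sub; rewrite inE hs orbT.
rewrite sigma_minor2 ?IH //; first by rewrite exprS mulN1r mulNr.
- by apply: sub; rewrite inE eqxx.
- exact: word_map_supported.
- exact: word_map_supported.
Qed.

(* An even word in two letters permuting the simple roots fixes them: it is
   either trivial or a transposition on the rank two part, and the latter is
   excluded by the determinant. *)
Lemma even_rank_two_id i k a s : i != k -> {subset s <= pred2 i k} ->
  ~~ odd (size s) -> (forall l, nonneg (word_map C a s (alpha l))) ->
  word_map C a s = id.
Proof.
move=> ik sub even ps; have perm := word_map_simple ps.
have iik : i \in pred2 i k by rewrite inE eqxx.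
have kik : k \in pred2 i k by rewrite !inE eqxx orbT.
have det := word_map_minor2 a ik sub (supported_alpha iik) (supported_alpha kik).
rewrite -signr_odd (negPf even) mul1r in det.
have in2 l j :
  l \in pred2 i k -> word_map C a s (alpha l) = alpha j -> j = i \/ j = k.
  move=> lik lj; have /(_ j) := word_map_supported C a sub (supported_alpha lik).
  rewrite lj ffunE eqxx => jik; apply/pred2P; apply: contraT => /jik /eqP.
  by rewrite mulr1n oner_eq0.
have fixed l : word_map C a s (alpha l) = alpha l.
  have [lik|lik] := boolP (l \in pred2 i k); last first.
    have [j lj] := perm l; rewrite lj.
    have : word_map C a s (alpha l) l = 1.
      by rewrite word_map_coord ?ffunE ?eqxx //; apply: contra lik; apply: sub.
    by rewrite lj ffunE; case: eqP => // ->.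
  have [j ij] := perm i; have [j' kj'] := perm k.
  move: det; rewrite ij kj' /minor2 !ffunE !eqxx [k == i]eq_sym (negPf ik).
  have [jE|jE] := in2 _ _ iik ij; have [j'E|j'E] := in2 _ _ kik kj';
    move: ij kj'; rewrite jE j'E ?eqxx ?(negPf ik) ?[k == i]eq_sym ?(negPf ik) //
      => ij kj' _.
  by case/pred2P: lik => ->.
apply: funext => x; rewrite (additive_expand (word_map C a s)) {2}[x]lattice_expand.
by apply: eq_bigr => l _ /=; rewrite fixed.
Qed.

Lemma longest_same i k a q q' : i != k ->
  longest i k a q -> longest i k a q' ->
  word_source C a q = word_source C a q' -> same_morphism a q q'.
Proof.
move=> ik lq lq' qq'; split=> //.
have [gq sq nq] := lq; have [gq' sq' nq'] := lq'.
(* The quotient of the two words: its length is even, and on rank two roots the sign changes caused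
   by [q] and [q'] cancel. *)
pose s := q ++ rev q'.
have sE x : word_map C a s x = word_map C a q (word_inv a q' x).
  by rewrite /s word_map_cat qq' word_inv_rev.
have sub : {subset s <= pred2 i k}.
  by move=> l; rewrite mem_cat mem_rev => /orP[/sq|/sq'].
have Rs l : R a (word_map C a s (alpha l)) by apply/root_word_map/root_alpha.
suff sid : word_map C a s = id.
  apply: funext => x; rewrite -{1}[x](word_mapK C a q').
  by rewrite -sE sid.
apply: (even_rank_two_id ik sub) => [|l].
  by rewrite /s size_cat size_rev -(longest_size lq lq') addnn odd_double.
have [lik|lik] := boolP (l \in pred2 i k); last first.
  apply: (root_nonneg_coord rootC (Rs l) (j := l)).
  by rewrite word_map_coord ?ffunE ?eqxx //; apply: contra lik; apply: sub.
apply: contraT; rewrite -(root_nonnegN rootC (Rs l)) => sn.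
have := root_negative_span (root_opp (Rs l)) sn _ nq.
rewrite word_invN sE word_mapK.
rewrite (root_nonnegN rootC (root_word_inv q' (root_alpha C a l))) nq' //; apply.
move=> j jik; rewrite ffunE -sE word_map_coord;
  last by apply: contra jik; apply: sub.
by rewrite (supported_alpha lik) ?oppr0.
Qed.

(** The braid relation: a longest word is alternating and can be exchanged for the alternating word
    starting with the other letter. *)
Lemma longest_head i k a q j : i != k -> longest i k a q -> j \in pred2 i k ->
  exists q', [/\ same_morphism a q (j :: q'), size q = (size q').+1
    & {subset q' <= pred2 i k}].
Proof.
wlog -> : i k / j = i => [Hw ik lq jik|ik lq _].
  have /pred2P[ji|jk] := jik; first exact: Hw.
  have [|||q' [? ? sub]] := Hw k i jk.
  - by rewrite eq_sym.
  - exact: longestC.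
  - by rewrite inE jk eqxx.
  by exists q'; split=> // l /sub; rewrite !inE orbC.
have [gq sq nq] := lq; case: q lq gq sq nq => [|y q] lq gq sq nq.
  by have := nq i; rewrite inE eqxx nonneg_alpha => /(_ isT).
have sub : {subset q <= pred2 i k} by move=> l lq'; apply: sq; rewrite inE lq' orbT.
have /pred2P[yi|yk] : y \in pred2 i k by apply: sq; rewrite inE eqxx.
  by exists q; rewrite yi.
subst y.
have qE : k :: q = alternating k i (size q).+1.
  apply: shortest_alternating (good_shortest rootC gq) _ => l /sq.
  by rewrite !inE orbC.
(* Prefixed by [i], this is the alternating word of length [size (k :: q)] that starts with [i]. *)
exists (alternating k i (size q)); rewrite size_alternating; split=> //.
  rewrite -[i :: _]/(alternating i k (size (k :: q))).
  apply: (longest_same ik lq (longest_alternating lq)).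
  by rewrite (longest_source ik lq) {1}qE.
by move=> l /alternating_sub; rewrite !inE orbC.
Qed.

End RankTwo.

(** * Exchange property *)

Section Exchange.
Set Implicit Arguments.
Unset Strict Implicit.
Unset Printing Implicit Defensive.
Import Order.TTheory GRing.Theory Num.Theory.
Local Open Scope ring_scope.
Context {I A : finType} (C : cartan_scheme I A).
Hypothesis rootC : is_root_system C (real_roots C).
Local Notation word_inv := (word_inv C).
Local Notation good := (good C).
Local Notation shortest := (shortest C).
Local Notation same_morphism := (same_morphism C).
Implicit Types (i j k l : I) (a : A) (s t q r : seq I).

(** For a shortest word [s] this says that [i] is a left descent, with remainder [r]. *)
Definition left_factor a s i r : Prop :=
  same_morphism a s (i :: r) /\ size s = (size r).+1.

Lemma shortest_no_left_factor a i s r :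
  shortest a (i :: s) -> ~ left_factor (rho C i a) s i r.
Proof.
move=> ls [sr sz]; have := ls r (same_trans (same_cons sr) (same_cancel C a i r)).
by rewrite /= sz ltnNge leqnSn.
Qed.

(** Letters of [K] are split off at the front as long as possible; the remainder gets shorter each
    time. *)
Lemma factor_out (K : {pred I}) a s : exists t r,
  [/\ {subset t <= K}, same_morphism a s (t ++ r), size s = (size t + size r)%N
    & {in K, forall k r', ~ left_factor (word_source C a t) r k r'}].
Proof.
have [n] := ubnP (size s); elim: n a s => // n IH a s; rewrite ltnS => sn.
have [[k [kK [r' [sr sz]]]]|no] :=
    pselect (exists k, k \in K /\ exists r', left_factor a s k r'); last first.
  exists [::], s; split=> // k kK r' sr'.
  by apply: no; exists k; split=> //; exists r'.
have [t [r [tK r'tr szr tr]]] : exists t r,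
    [/\ {subset t <= K}, same_morphism (rho C k a) r' (t ++ r),
        size r' = (size t + size r)%N
      & {in K, forall j r'', ~ left_factor (word_source C (rho C k a) t) r j r''}].
  by apply: IH; rewrite -sz.
exists (k :: t), r; split=> //.
- by move=> l; rewrite inE => /predU1P[-> //|/tK].
- exact: same_trans sr (same_cons r'tr).
- by rewrite sz szr.
Qed.

(** Should prepending [j] to a good word destroy goodness, that word would be longest. It could then
    be rewritten to start with [j], and the two copies of [j] would cancel. *)
Lemma shortest_good_rank_two i k a q :
  i != k -> {subset q <= pred2 i k} -> shortest a q -> good a q.
Proof.
move=> ik; elim: q a => // j q IH a sub lq.
have sub' : {subset q <= pred2 i k}.
  by move=> l lq'; apply: sub; rewrite inE lq' orbT.
have gq := IH _ sub' (shortest_cons lq).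
apply: good_cons => //; apply: contraT => jn; exfalso.
have jik : j \in pred2 i k by apply: sub; rewrite inE eqxx.
(* Besides [j], the first letter [y] of [q] is made negative as well, and these two exhaust [i] and
   [k]. *)
have Lq : longest C i k (rho C j a) q.
  split=> // l lik; case: q => [|y q] in lq sub sub' gq jn {IH} *.
    by rewrite nonneg_alpha in jn.
  have jy := shortest_head lq.
  have yn : ~~ nonneg (word_inv (rho C j a) (y :: q) (alpha y)).
    by apply: (good_inversions rootC gq); rewrite inE eqxx.
  have yik : y \in pred2 i k by apply: sub'; rewrite inE eqxx.
  suff /pred2P[->|->] : l \in pred2 j y by [].
  case/pred2P: jik jy => ->; case/pred2P: yik => ->; rewrite ?eqxx // => _.
  by move: lik; rewrite !inE orbC.
have [q' [qq' sz _]] := longest_head rootC ik Lq jik.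
exact: shortest_no_left_factor lq (conj qq' sz).
Qed.

(** Induction on length. With [k] the first letter, split off a maximal prefix [t] in [i] and [k].
    The remainder keeps both simple roots positive, so [t] must make them negative; being longest,
    it can start with [i]. *)
Lemma exchange a s i : shortest a s -> ~~ nonneg (word_inv a s (alpha i)) ->
  exists r, left_factor a s i r.
Proof.
have [n] := ubnP (size s); elim: n a s i => // n IH a [|k s] i.
  by rewrite /= nonneg_alpha.
rewrite ltnS => sn ls neg.
have [->|ki] := eqVneq i k; first by exists s.
have [t [r [tK str sz tr]]] := factor_out (pred2 i k) a (k :: s).
have ltr : shortest a (t ++ r).
  by apply: shortest_same ls str _; rewrite size_cat -sz.
(* The prefix [t] is nonempty, since [k] can be split off. *)
have rn : (size r < n)%N.
  case: t => [|j t] in str sz tr {tK ltr} *.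
    have := tr k _ s (conj (same_sym str) (esym sz)).
    by rewrite !inE eqxx orbT => /(_ isT).
  by apply: leq_trans sn; move: sz => /= [->]; rewrite ltnS leq_addl.
have rp :
  {in pred2 i k, forall l, nonneg (word_inv (word_source C a t) r (alpha l))}.
  move=> l lik; apply: contraT => /(IH _ _ _ rn (shortest_catr ltr))[r' /tr].
  by case.
(* Otherwise the tail would make [alpha k] negative and, by induction, could start with [k],
   contrary to minimality. *)
have kn : ~~ nonneg (word_inv a (k :: s) (alpha k)).
  have Rk := root_word_inv s (root_alpha C (rho C k a) k).
  rewrite /= sigma_simple word_invN (root_nonnegN rootC Rk) negbK.
  apply: contraT => /(IH _ _ _ sn (shortest_cons ls))[r' sr'].
  by case: (shortest_no_left_factor ls sr').
have tn : {in pred2 i k, forall l, ~~ nonneg (word_inv a t (alpha l))}.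
  move=> l lik; have : ~~ nonneg (word_inv a (k :: s) (alpha l)).
    by case/pred2P: lik => ->.
  rewrite (same_inv str) word_inv_cat /=; apply: contra => lp.
  apply: (additive_nonneg rp lp).
  exact: word_inv_supported tK (supported_alpha lik).
have Lt : longest C i k a t.
  by split=> //; apply: shortest_good_rank_two ki tK (shortest_catl ltr).
have iik : i \in pred2 i k by rewrite inE eqxx.
have [t' [tt' szt _]] := longest_head rootC ki Lt iik.
exists (t' ++ r); split; last by rewrite sz szt size_cat.
exact: same_trans str (same_cat tt' (same_refl _ _ _)).
Qed.

Lemma shortest_good a s : shortest a s -> good a s.
Proof.
elim: s a => // i s IH a ls; have gs := IH _ (shortest_cons ls).
apply: good_cons => //; apply: contraT => /(exchange (shortest_cons ls))[r sr].
by case: (shortest_no_left_factor ls sr).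
Qed.

Lemma shortest_letters a s t :
  shortest a s -> same_morphism a s t -> {subset s <= t}.
Proof. by move=> ls; apply: good_letters => //; apply: shortest_good. Qed.

End Exchange.

(** * Letters and weak order of morphisms *)

Section Morphisms.
Set Implicit Arguments.
Unset Strict Implicit.
Unset Printing Implicit Defensive.
Import Order.TTheory GRing.Theory Num.Theory.
Local Open Scope ring_scope.
Context {I A : finType} (C : cartan_scheme I A).
Hypothesis rootC : is_root_system C (real_roots C).
Local Notation word_inv := (word_inv C).
Local Notation good := (good C).
Local Notation shortest := (shortest C).
Local Notation same_morphism := (same_morphism C).
Implicit Types (i j k l : I) (a b c d : A) (s t q r : seq I).

Lemma decomposes_same b a (w : wg_hom C b a) s t :
  decomposes C b a w s -> decomposes C b a w t -> same_morphism a s t.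
Proof. by move=> [sb sw] [tb tw]; split; rewrite ?sb ?sw. Qed.

Lemma same_decomposes b a (w : wg_hom C b a) s t :
  same_morphism a s t -> decomposes C b a w s -> decomposes C b a w t.
Proof. by move=> [ss sm] [sb sw]; split; rewrite -?ss -?sm. Qed.

Lemma hom_length_le b a (w : wg_hom C b a) s :
  decomposes C b a w s -> (hom_length w <= size s)%N.
Proof.
move=> ws; rewrite /hom_length; case: ex_minnP => n _; apply.
by apply/asboolP; exists s.
Qed.

Lemma reducedE b a (w : wg_hom C b a) s :
  reduced w s <-> decomposes C b a w s /\ shortest a s.
Proof.
split=> [[ws sz]|[ws ls]]; split=> //.
  by move=> t st; rewrite sz; apply: hom_length_le; apply: same_decomposes st ws.
apply/eqP; rewrite eqn_leq hom_length_le // andbT.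
by have [t [wt <-]] := reduced_exists w; apply: ls; apply: decomposes_same ws wt.
Qed.

Lemma letters_reduced b a (w : wg_hom C b a) s :
  reduced w s -> letters w = [set:: s].
Proof.
rewrite /letters; case: cid => t /= /reducedE[wt lt] /reducedE[ws ls].
have st := decomposes_same ws wt.
apply/setP => i; rewrite !inE; apply/idP/idP.
  exact: (shortest_letters rootC lt (same_sym st)).
exact: (shortest_letters rootC ls st).
Qed.

Lemma letters_sub b a (w : wg_hom C b a) s :
  decomposes C b a w s -> {subset letters w <= s}.
Proof.
move=> ws; have [t rt] := reduced_exists w; rewrite (letters_reduced rt) => i.
have /reducedE[wt lt] := rt; rewrite inE.
exact: (shortest_letters rootC lt (decomposes_same wt ws)).
Qed.

Lemma decomposes_comp c b a (u : wg_hom C b a) (v : wg_hom C c b) s t :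
  decomposes C b a u s -> decomposes C c b v t ->
  decomposes C c a (hom_comp u v) (s ++ t).
Proof.
move=> [sb su] [tc tv].
by split; rewrite ?word_source_cat ?word_map_cat sb ?tc ?su ?tv.
Qed.

Lemma hom_compK b a (u : wg_hom C b a) c (v : wg_hom C c a) :
  hom_comp u (hom_comp (hom_inv u) v) = v.
Proof.
rewrite /hom_inv; case: cid => ui /= [uui _]; apply: hom_ext.
apply: funext => x; exact: (congr1 (fun w : wg_hom C a a => hom_map w (v x)) uui).
Qed.

Lemma decomposes_inv b a (u : wg_hom C b a) s :
  decomposes C b a u s -> decomposes C a b (hom_inv u) (rev s).
Proof.
move=> [sb su]; split; first by rewrite -sb word_source_rev.
rewrite -[in LHS]sb word_inv_rev; apply: funext => x.
rewrite /hom_inv; case: cid => ui /= [uui _].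
have uuix : u (ui x) = x := congr1 (fun w : wg_hom C a a => hom_map w x) uui.
by rewrite -[in LHS]uuix -su word_mapK.
Qed.

(** * Letters along the weak order *)

Lemma weak_le_letters c b a (m : wg_hom C c a) (u : wg_hom C b a) :
  weak_le m u -> letters m \subset letters u.
Proof.
move=> [v [uE sz]]; have [s rs] := reduced_exists m; have [t rt] := reduced_exists v.
have rst : reduced u (s ++ t).
  have [ms ss] := rs; have [vt st] := rt; split; last by rewrite size_cat ss st.
  by rewrite uE; apply: decomposes_comp.
rewrite (letters_reduced rs) (letters_reduced rst); apply/fintype.subsetP => i.
by rewrite !inE mem_cat => ->.
Qed.

Definition hom_of_word a s : wg_hom C (word_source C a s) a :=
  WgHom (ex_intro _ s (conj erefl erefl)).

Lemma weak_le_prefix b a (w : wg_hom C b a) s t :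
  reduced w (s ++ t) -> weak_le (hom_of_word a s) w.
Proof.
move=> rst; have /reducedE[[cb cw] lst] := rst; have [_ sz] := rst.
have vt : exists r, decomposes C b (word_source C a s)
    (word_map C (word_source C a s) t) r.
  by exists t; rewrite /decomposes -word_source_cat.
exists (WgHom vt); split; first by apply: hom_ext; rewrite -cw word_map_cat.
rewrite -sz size_cat.
have [|_ <-] := (reducedE (hom_of_word a s) s).2.
  by split=> //; apply: shortest_catl lst.
have [|_ <-] := (reducedE (WgHom vt) t).2; last by [].
by split; [rewrite /decomposes -word_source_cat | apply: shortest_catr lst].
Qed.

Lemma meet_letters b c d a (u : wg_hom C b a) (v : wg_hom C c a) (m : wg_hom C d a) :
  is_meet u v m ->
  letters u :|: letters v \subset
  letters m :|: letters (hom_comp (hom_inv u) v).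
Proof.
move=> [_ _ mP]; set w := hom_comp (hom_inv u) v.
have [s rs] := reduced_exists u; have /reducedE[us ls] := rs.
have [r rr] := reduced_exists w; have /reducedE[wr lr] := rr.
rewrite (letters_reduced rr).
have vsr : decomposes C c a v (s ++ r).
  by rewrite -(hom_compK u v); apply: decomposes_comp.
have [sb _] := us; have [rc _] := wr.
have lrs : shortest b (rev s) by rewrite -sb; apply: shortest_rev.
(* Working with inverses, $u^{-1}=yx$ where [y] uses letters of [r] and [x] has no left descent
   among them; [rev x] will be the common lower bound. *)
have [y [x [yK syx sz xK]]] := factor_out C (mem r) b (rev s).
have lyx : shortest b (y ++ x).
  by apply: shortest_same lrs syx _; rewrite size_cat -sz.
have lx := shortest_catr lyx.
have yxa : word_source C b (y ++ x) = a.
  by case: syx => <- _; rewrite -sb word_source_rev.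
have xp : {in mem r, forall k, nonneg (word_inv (word_source C b y) x (alpha k))}.
  by move=> k kr; apply: contraT => /(exchange rootC lx)[r' /xK]; case.
have ru : reduced u (rev x ++ rev y).
  rewrite -rev_cat; apply/reducedE; split; last by rewrite -yxa; apply: shortest_rev.
  apply: same_decomposes us; have := same_rev syx.
  by rewrite revK -sb word_source_rev.
have cr : word_source C c (rev r) = b by rewrite -rc word_source_rev.
(* Since $v^{-1}=(u^{-1}v)^{-1}u^{-1}$, the word [rev r ++ y ++ x] represents $v^{-1}$; its part
   over the letters of [r] is shortened to [z]. *)
have [z yz lz] := shortest_exists C c (rev r ++ y).
have zr : {subset z <= mem r}.
  move=> i /(shortest_letters rootC lz (same_sym yz)).
  by rewrite mem_cat mem_rev => /orP[|/yK].
have zy : word_source C c z = word_source C b y.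
  by case: yz => <- _; rewrite word_source_cat cr.
(* The inverse of [x] keeps the simple roots indexed by [r] positive, so lengths add up. *)
have lzx : shortest c (z ++ x).
  apply: (good_shortest rootC); apply: (good_cat rootC (K := mem r)) => //.
  - exact: shortest_good lz.
  - by rewrite zy; apply: shortest_good lx.
  - by rewrite zy.
have szx : same_morphism c (z ++ x) (rev (s ++ r)).
  apply: (@same_trans _ _ _ _ _ ((rev r ++ y) ++ x)).
    by apply: same_cat (same_sym yz) _; split.
  rewrite -catA rev_cat; apply: same_cat; first by [].
  by rewrite cr; apply: same_sym.
have zxa : word_source C c (z ++ x) = a.
  by rewrite word_source_cat zy -word_source_cat.
have rv : reduced v (rev x ++ rev z).
  rewrite -rev_cat; apply/reducedE; split; last by rewrite -zxa; apply: shortest_rev.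
  apply: same_decomposes vsr; have := same_rev szx.
  by rewrite revK zxa => /same_sym.
(* The common prefix [rev x] lies below the meet, which therefore contains the letters of [x]; those
   of [y] and [z] are in [r]. *)
have := weak_le_letters (mP _ _ (weak_le_prefix ru) (weak_le_prefix rv)).
have rx : reduced (hom_of_word a (rev x)) (rev x).
  by apply/reducedE; split=> //; have /reducedE[_ /shortest_catl] := ru.
rewrite (letters_reduced rx) (letters_reduced ru) (letters_reduced rv).
move=> /fintype.subsetP xm; apply/fintype.subsetP => i.
have {xm} xm : i \in x -> i \in letters m.
  by move=> ix; apply: xm; rewrite inE mem_rev.
have yr : i \in y -> i \in r := @yK i; have {}zr : i \in z -> i \in r := @zr i.
move: (letters m) xm => M xm.
by rewrite !inE !mem_cat !mem_rev -orbA => /or4P[/xm|/yr|/xm|/zr] ->; rewrite ?orbT.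
Qed.

End Morphisms.

(** * Equality of the two sets of letters *)

Theorem theorem3p21 (I A : finType) (C : cartan_scheme I A)
    (hC : is_finite_root_system C (real_roots C))
    (a b c d : A) (u : wg_hom C b a) (v : wg_hom C c a) (m : wg_hom C d a)
    (hm : is_meet u v m) :
  (letters u :|: letters v =
   letters m :|: letters (hom_comp (hom_inv u) v))%SET.
Proof.
have [rootC _] := hC; have [mu mv _] := hm.
apply/eqP; rewrite finset.eqEsubset meet_letters //= finset.subUset;
  apply/andP; split.
  exact: fintype.subset_trans (weak_le_letters rootC mu) (finset.subsetUl _ _).
(* The word [rev s ++ t] represents $u^{-1}v$ and has only letters of [u] and [v]. *)
have [s rs] := reduced_exists u; have [t rt] := reduced_exists v.
rewrite (letters_reduced rootC rs) (letters_reduced rootC rt).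
have [us _] := rs; have [vt _] := rt; apply/fintype.subsetP => i.
move/(letters_sub rootC (decomposes_comp (decomposes_inv us) vt)).
by rewrite !inE mem_cat mem_rev.
Qed.
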